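(* Let $p:[0,\infty)\to[0,\infty)$ be an $\mathcal O$-regularly varying function such that $p(t)$ is non-decreasing and $t^{-1}p(t)$ is non-increasing for all sufficiently large $t$. If $$S_n-\mu|n|=o(p(|n|))\quad\text{a.s. as } n\to\infty,\ n\in\mathbb N^d,$$ then, for every $\varepsilon>0$, almost surely for all sufficiently large $t$, $$\mathcal H(\varepsilon p(t)t^{-1})\subset t^{-1/d}\mathcal M_t\subset\mathcal H(-\varepsilon p(t)t^{-1}).$$
   Context: Throughout, $d\ge2$ is an integer, $\mathbb N=\{1,2,\dots\}$, $\mathbb R_+^d=[0,\infty)^d$. Components of a vector $x$ are $x^1,\dots,x^d$; for a vector $x\in\mathbb R_+^d$ write $|x|=x^1\cdots x^d$ (product of components). $m\le n$ for vectors is the componentwise order. $n\to\infty$ means $\max\{n^1,\dots,n^d\}\to\infty$. $\{\xi_m,\ m\in\mathbb N^d\}$ are independent copies of an integrable random variable $\xi$ with finite mean $\mu=\mathbf E\xi>0$. $S_n=\sum_{m\le n}\xi_m$ for $n\in\mathbb N^d$, and $S_n=0$ if $n$ has non-negative integer components at least one of which is zero. $S$ is extended to $\mathbb R_+^d$ by piecewise multilinear interpolation: $S_x=\sum_{k\in C_x}v_k(x)S_{k^*}$, where $C_x$ is the set of vertices of a unit cube (with integer vertices, in $\mathbb R_+^d$) containing $x$, $v_k(x)=\prod_{i=1}^d|x^i-k^i|$ is the volume of the axis-parallel box with diagonally opposite vertices $k$ and $x$, and $k^*$ is the vertex of the cube opposite to $k$ (the value does not depend on the choice of the cube). Renewal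 sets: $\mathcal M_t=\{x\in\mathbb R_+^d: S_x\ge t\}$, $t>0$. For $c\in\mathbb R$, $\mathcal H(c)=\{x\in\mathbb R_+^d:|x|\ge\mu^{-1}+c\}$. A function $p:[0,\infty)\to[0,\infty)$ that is positive for all sufficiently large arguments is called $\mathcal O$-regularly varying if $\limsup_{t\to\infty}p(ct)/p(t)<\infty$ for all $c>0$. ''Almost surely for all sufficiently large $t$'' means: with probability one there is a (possibly random) $t_0$ such that the assertion holds for all $t\ge t_0$. *)

(* Defs.v *)
From HB Require Import structures.
From mathcomp Require Import all_boot all_order all_algebra finmap.
From mathcomp Require Import all_classical all_reals all_analysis.

Set Implicit Arguments.
Unset Strict Implicit.
Unset Printing Implicit Defensive.

Import Order.TTheory GRing.Theory Num.Theory.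
Import numFieldNormedType.Exports.

Local Open Scope classical_set_scope.
Local Open Scope ring_scope.

(* Integer points with components >= 0. The positive points, i.e. N^d with
   N = {1, 2, ...}, are carved out by [pos_lattice]. *)
Definition lattice (d : nat) := {ffun 'I_d -> nat}.

Definition pos_lattice {d : nat} : set (lattice d) :=
  [set n | forall i, (0 < n i)%N].

(* n -> oo in N^d, meaning max {n^1, ..., n^d} -> oo. *)
Definition lattice_infty {d : nat} : set_system (lattice d) :=
  filter_from [set: nat]
    (fun K => [set n | pos_lattice n /\ (K <= \max_(i < d) n i)%N]).

Global Instance lattice_infty_filter (d : nat) : Filter (@lattice_infty d).
Proof.
apply: filter_from_filter; first by exists 0%N.
move=> K L _ _; exists (maxn K L) => // n [n0].
by rewrite geq_max => /andP[Kn Ln]; split; split.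
Qed.

Canonical lattice_infty_filter_on (d : nat) :=
  FilterType (@lattice_infty d) (@lattice_infty_filter d).

Definition lattice_pt (R : realType) (d : nat) (n : lattice d) : 'rV[R]_d :=
  \row_(i < d) (n i)%:R.

Definition orthant (R : realType) (d : nat) : set 'rV[R]_d :=
  [set x | forall i, 0 <= x ord0 i].

(* The quantity written |x|. *)
Definition vol (R : realType) (d : nat) (x : 'rV[R]_d) : R :=
  \prod_(i < d) x ord0 i.

(* S_n; when some component of n is zero the index set is empty, so S_n = 0. *)
Definition partial_sum (R : realType) (d : nat) (z : lattice d -> R)
    (n : lattice d) : R :=
  \sum_(m \in [set m | pos_lattice m /\ forall i, (m i <= n i)%N]) z m.

(* Vertices of the unit cube with lowest corner [a] are indexed by subsets of
   the coordinates; complementary subsets give opposite vertices. *)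
Definition cube_vertex (d : nat) (a : lattice d) (e : {set 'I_d}) : lattice d :=
  [ffun i => (a i + (i \in e))%N].

Definition box_vol (R : realType) (d : nat) (k : lattice d) (x : 'rV[R]_d) : R :=
  \prod_(i < d) `|x ord0 i - (k i)%:R|.

(* Among the unit cubes containing x, the one whose lowest corner is the
   componentwise integer part of x is used; on a common face the other cubes
   give the same value. *)
Definition interpolation (R : realType) (d : nat) (S : lattice d -> R)
    (x : 'rV[R]_d) : R :=
  let a : lattice d := [ffun i => Num.truncn (x ord0 i)] in
  \sum_(e : {set 'I_d})
    box_vol (cube_vertex a e) x * S (cube_vertex a (~: e)).

Definition renewal_set (R : realType) (d : nat) (S : lattice d -> R) (t : R) :
    set 'rV[R]_d :=
  [set x | orthant x /\ t <= interpolation S x].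

Definition hyperbolic_set (R : realType) (d : nat) (mu c : R) : set 'rV[R]_d :=
  [set x | orthant x /\ mu^-1 + c <= vol x].

Definition scale_set (R : realType) (d : nat) (a : R) (A : set 'rV[R]_d) :
    set 'rV[R]_d :=
  [set a *: x | x in A].

(* Only the values of p on [0, oo[ are meaningful. *)
Definition O_regularly_varying (R : realType) (p : R -> R) : Prop :=
  (\forall t \near +oo, 0 < p t) /\
  forall c : R, 0 < c ->
    (limf_esup (fun t : R => (p (c * t) / p t)%:E) +oo%R < +oo)%E.

Definition mutually_independent (disp : measure_display)
    (T : measurableType disp) (R : realType) (P : probability T R)
    (I : choiceType) (D : set I) (X : I -> {RV P >-> R}) : Prop :=
  forall (J : {fset I}) (B : I -> set R),
    [set` J] `<=` D -> (forall i, measurable (B i)) ->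
    P (\bigcap_(i in [set` J]) (X i @^-1` B i)) =
    (\prod_(i <- J) P (X i @^-1` B i))%E.

(* Equality of laws is required on measurable sets only: a library measure is a
   function on all sets, unconstrained outside the sigma-algebra. *)
Definition same_law (disp : measure_display)
    (T : measurableType disp) (R : realType) (P : probability T R)
    (X Y : {RV P >-> R}) : Prop :=
  forall B : set R, measurable B -> distribution P X B = distribution P Y B.

Definition independent_copies (disp : measure_display)
    (T : measurableType disp) (R : realType) (P : probability T R)
    (I : choiceType) (D : set I) (X : I -> {RV P >-> R}) (Y : {RV P >-> R}) :
    Prop :=
  mutually_independent D X /\ forall i, D i -> same_law (X i) Y.

(* Main.v *)
(* On the almost sure event of the hypothesis the argument is deterministic.
   Since |x| is multilinear, it is its own interpolation, so S_x - mu |x| is the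
   interpolation of the errors S_k - mu |k|.  A vertex k with weight v satisfies
   v |k| <= 2 ^ d |x|: if |k| <= |x|, then p(|k|) <= p(|x|) by monotonicity of p,
   and otherwise v p(|k|) <= v |k| p(|x|) / |x| <= 2 ^ d p(|x|) by monotonicity of
   p(t) / t.  Hence S_x - mu |x| = o(p(|x|)) as |x| -> oo, uniformly in x, also
   near the boundary of the orthant.  Points with |x| bounded are excluded from
   the renewal set for large t by an affine bound on the error.  The inclusions
   then follow by inverting s |-> mu s +- delta p(s) at s = t / mu +- eps p(t),
   where p(s) = O(p(t)) because p(C t) <= C p(t) for C >= 1. *)

Require Import Defs.
From HB Require Import structures.
From mathcomp Require Import all_boot all_order all_algebra finmap.
From mathcomp Require Import all_classical all_reals all_analysis.
From mathcomp Require Import ring lra.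

Set Implicit Arguments.
Unset Strict Implicit.
Unset Printing Implicit Defensive.

Import Order.TTheory GRing.Theory Num.Theory.
Import numFieldNormedType.Exports.

Local Open Scope classical_set_scope.
Local Open Scope ring_scope.

(** * Volumes and partial sums at points of the orthant *)

Lemma vol_ge0 (R : realType) (d : nat) (x : 'rV[R]_d) :
  orthant x -> 0 <= vol x.
Proof. by move=> x0; apply: prodr_ge0. Qed.

Lemma vol_scale (R : realType) (d : nat) (a : R) (x : 'rV[R]_d) :
  vol (a *: x) = a ^+ d * vol x.
Proof.
rewrite /vol -[in X in a ^+ X](card_ord d) -prodr_const -big_split /=.
by apply: eq_bigr => i _; rewrite mxE.
Qed.

Lemma vol_lattice_pt_ge0 (R : realType) (d : nat) (n : lattice d) :
  0 <= vol (lattice_pt R n).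
Proof. by apply: vol_ge0 => i; rewrite mxE. Qed.

Lemma le_vol_lattice_pt (R : realType) (d : nat) (n : lattice d) (j : 'I_d) :
  pos_lattice n -> (n j)%:R <= vol (lattice_pt R n).
Proof.
move=> npos; rewrite /vol (bigD1 j) //= mxE ler_peMr //.
apply: (@le_trans _ _ (\prod_(i < d | i != j) 1)); first by rewrite big1.
by apply: ler_prod => i _; rewrite mxE ler01 ler1n npos.
Qed.

Lemma vol_lattice_pt_eq0 (R : realType) (d : nat) (n : lattice d) :
  ~ pos_lattice n -> vol (lattice_pt R n) = 0.
Proof.
move=> /existsNP[i /negP]; rewrite lt0n negbK => /eqP ni0.
by rewrite /vol (bigD1 i) //= mxE ni0 mul0r.
Qed.

Lemma partial_sum_eq0 (R : realType) (d : nat) (z : lattice d -> R)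
    (n : lattice d) :
  ~ pos_lattice n -> partial_sum z n = 0.
Proof.
move=> /existsNP[i /negP]; rewrite lt0n negbK => /eqP ni0.
rewrite /partial_sum (_ : [set m | _] = set0) ?fsbig_set0 //.
apply/seteqP; split => // m [] mpos /(_ i).
by rewrite ni0 leqn0 => /eqP mi0; move: (mpos i); rewrite mi0.
Qed.

(** * Multilinear interpolation over a unit cube *)

Lemma interpolation_vol (R : realType) (d : nat) (x : 'rV[R]_d) :
  orthant x -> interpolation (fun n => vol (lattice_pt R n)) x = vol x.
Proof.
move=> x0; rewrite /interpolation /box_vol /vol /=.
under eq_bigr do rewrite -big_split /=.
set a := fun i => Num.truncn (x ord0 i).
rewrite (eq_bigr (fun e : {set 'I_d} => \prod_i
  if i \in e then `|x ord0 i - (a i + 1)%:R| * (a i)%:R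
  else `|x ord0 i - (a i)%:R| * (a i + 1)%:R)); last first.
  move=> e _; apply: eq_bigr => i _; rewrite !mxE !ffunE inE.
  by case: (i \in e); rewrite ?addn0.
(* The sum over vertices of products factors into a product over coordinates, whose factors are
   [(a + 1 - x) * a + (x - a) * (a + 1) = x]. *)
rewrite -bigA_distr; apply: eq_bigr => i _.
have /andP[ax xa] := truncn_itv (x0 i); rewrite -/(a i) in ax xa.
rewrite addn1 ler0_norm ?ger0_norm ?subr_ge0 ?subr_le0 //; last exact: ltW.
rewrite -natr1 /=; ring.
Qed.

Lemma interpolation_sub (R : realType) (d : nat) (mu : R)
    (S : lattice d -> R) (x : 'rV[R]_d) : orthant x ->
  interpolation (fun n => S n - mu * vol (lattice_pt R n)) x =
  interpolation S x - mu * vol x.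
Proof.
move=> x0; rewrite -(interpolation_vol x0) /interpolation mulr_sumr -sumrB.
by apply: eq_bigr => e _; ring.
Qed.

(** A cube has [2 ^ d] vertices, so it suffices to bound each weighted term by [M]. The premise
    keeps only what later estimates use about a weight [v] and its vertex [n], so that cubes need
    not be opened again. *)
Lemma normr_interpolation_le (R : realType) (d : nat) (S : lattice d -> R)
    (x : 'rV[R]_d) (M : R) : orthant x ->
  (forall (v : R) (n : lattice d), 0 <= v <= 1 ->
     (forall i, (Num.truncn (x ord0 i) <= n i)%N) ->
     v * vol (lattice_pt R n) <= 2 ^+ d * vol x -> v * `|S n| <= M) ->
  `|interpolation S x| <= 2 ^+ d * M.
Proof.
move=> x0 SM; rewrite /interpolation; set a := [ffun i => _].
apply: le_trans (ler_norm_sum _ _ _) _.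
have -> : 2 ^+ d * M = \sum_(e : {set 'I_d}) M.
  rewrite sumr_const -[RHS]mulr_natl; congr (_ * _).
  by rewrite -cardsT -powersetT card_powerset cardsT card_ord natrX.
apply: ler_sum => e _; rewrite normrM.
have ax i : (a i)%:R <= x ord0 i < (a i)%:R + 1.
  by rewrite ffunE natr1; exact: truncn_itv.
have v_itv : 0 <= box_vol (cube_vertex a e) x <= 1.
  rewrite prodr_ge0 => [|//]; rewrite /=.
  apply: (@le_trans _ _ (\prod_(i < d) 1)); last by rewrite big1.
  apply: ler_prod => i _; rewrite normr_ge0 /= ffunE natrD.
  have /andP[? ?] := ax i.
  by rewrite ler_norml; case: (i \in e) => /=; apply/andP; split; lra.
rewrite ger0_norm; last by case/andP: v_itv.
apply: SM => // [i|].
  by rewrite [in X in (_ <= X)%N]ffunE;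
    apply: (@leq_trans (a i)); rewrite ?leq_addr // ffunE.
(* Coordinatewise, [(a + 1 - x) * a] and [(x - a) * (a + 1)] are at most [2 * x]. For the latter,
   [a + 1 <= 2 * a] if [a] is positive, and the product is [x] if [a = 0]. *)
rewrite /box_vol /vol -big_split /= -[in X in _ ^+ X](card_ord d) -prodr_const.
rewrite -big_split /=; apply: ler_prod => i _; rewrite mulr_ge0 ?mxE //=.
have /andP[alex xlta] := ax i.
rewrite [cube_vertex _ _ _]ffunE [in X in _ * X]ffunE !natrD inE.
have an0 : (0 : R) <= (a i)%:R by [].
case: (i \in e) => /=.
  by rewrite ler0_norm; nra.
rewrite addr0 ger0_norm; last lra.
have [->|ai] := posnP (a i); first lra.
have : (1 : R) <= (a i)%:R by rewrite ler1n.
by nra.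
Qed.

(** If all [n j < N], then each coordinate of [x] is below its integer part plus one, hence at most
    [N], and the volume is at most [N ^ d]. *)
Lemma exists_large_coordinate (R : realType) (d : nat) (x : 'rV[R]_d)
    (n : lattice d) (N : nat) : orthant x ->
  (forall i, (Num.truncn (x ord0 i) <= n i)%N) -> N%:R ^+ d < vol x ->
  exists j, (N <= n j)%N.
Proof.
move=> x0 xn Nx; apply: contrapT => /forallNP nN; move: Nx; apply/negP.
rewrite -leNgt /vol -[in X in _ ^+ X](card_ord d) -prodr_const.
apply: ler_prod => i _; rewrite x0 /=.
have /andP[_ /ltW xa] := truncn_itv (x0 i); apply: le_trans xa _.
rewrite ler_nat; apply: leq_ltn_trans (xn i) _.
by rewrite ltnNge; apply/negP/nN.
Qed.

(** The second inequality is the monotonicity of [p t / t], cross-multiplied to avoid division. *)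
Definition eventually_regular (R : realType) (t0 : R) (p : R -> R) : Prop :=
  forall s t, t0 <= s -> s <= t -> p s <= p t /\ p t * s <= p s * t.

(** * From errors at lattice points to interpolated errors *)

Section LatticeError.
Variables (R : realType) (d : nat) (p : R -> R) (t0 : R) (f : lattice d -> R).
Hypothesis p_ge0 : forall t, 0 <= t -> 0 <= p t.
Hypothesis p_reg : eventually_regular t0 p.
Hypothesis f_eq0 : forall n, ~ pos_lattice n -> f n = 0.
Hypothesis f_littleo : f =o_lattice_infty (fun n => p (vol (lattice_pt R n))).

(** The other coordinates are at least 1, so one coordinate beyond [N] pushes the volume past [N],
    hence past [t0], where the regularity of [p] applies. *)
Lemma lattice_error_le (delta : R) : 0 < delta -> exists N : nat,
  [/\ (0 < N)%N, t0 <= N%:R & forall n, pos_lattice n ->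
    (exists j, (N <= n j)%N) -> N%:R <= vol (lattice_pt R n) /\
      `|f n| <= delta * p (vol (lattice_pt R n))].
Proof.
move=> delta0; have /eqoP/(_ _ delta0)[K _ fK] := f_littleo.
exists (maxn K (Num.truncn (`|t0|)).+1); split; first by rewrite leq_max orbT.
  have /andP[_ /ltW] := truncn_itv (normr_ge0 t0).
  move=> /(le_trans (ler_norm t0)) t0le; apply: le_trans t0le _.
  by rewrite ler_nat leq_maxr.
move=> n npos [j Nj]; split.
  by apply: le_trans (le_vol_lattice_pt R j npos); rewrite ler_nat.
have /= := fK n; rewrite (ger0_norm (p_ge0 (vol_lattice_pt_ge0 R n))); apply.
split=> //; apply: leq_trans (leq_bigmax j).
by apply: leq_trans Nj; rewrite leq_maxl.
Qed.

Lemma interpolation_error_le (delta : R) : 0 < delta ->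
  exists X0 : R, forall x : 'rV[R]_d, orthant x -> X0 <= vol x ->
    `|interpolation f x| <= delta * p (vol x).
Proof.
move=> delta0; set c : R := 2 ^+ d.
have c0 : 0 < c by rewrite exprn_gt0.
have c1 : 1 <= c by rewrite exprn_ege1 // ler1n.
(* One factor [c] pays for the number of vertices, the other for the bound of [v] times the vertex
   volume by [c * vol x]. *)
have [|N [N0 t0N fN]] := @lattice_error_le (delta / (c * c)).
  by rewrite divr_gt0 ?mulr_gt0.
exists (Num.max (N%:R ^+ d + 1) t0) => x x0; rewrite ge_max => /andP[xN xt0].
have -> : delta * p (vol x) = c * (delta / (c * c) * (c * p (vol x))).
  by field; exact: lt0r_neq0.
apply: normr_interpolation_le => // v n /andP[v0 v1] xn vn.
have px0 : 0 <= p (vol x) by apply/p_ge0/vol_ge0.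
have [npos|nneg] := pselect (pos_lattice n); last first.
  by rewrite f_eq0 // normr0 mulr0 mulr_ge0 ?divr_ge0 ?mulr_ge0 //
             ?(ltW c0) ?(ltW delta0).
have Nn : exists j, (N <= n j)%N.
  by apply: exists_large_coordinate x0 xn _;
    apply: lt_le_trans xN; rewrite ltrDl.
have [Nvol fn] := fN n npos Nn.
apply: le_trans (ler_wpM2l v0 fn) _.
rewrite mulrCA ler_pM2l ?divr_gt0 ?mulr_gt0 // -/c in vn *.
have t0n := le_trans t0N Nvol.
have pn0 : 0 <= p (vol (lattice_pt R n)) by apply/p_ge0/vol_lattice_pt_ge0.
have [nx|xn'] := leP (vol (lattice_pt R n)) (vol x).
  have [pnx _] := p_reg t0n nx; nra.
have [_ pxn] := p_reg xt0 (ltW xn').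
have x_gt0 : 0 < vol x.
  by apply: lt_le_trans xN; rewrite ltr_wpDl // exprn_ge0.
rewrite -(ler_pM2r x_gt0) -mulrA.
apply: le_trans (ler_wpM2l v0 pxn) _; rewrite mulrCA [leRHS]mulrAC mulrC.
exact: ler_wpM2r.
Qed.

(** This covers points of small volume, which form an unbounded set near the boundary of the orthant
    and escape the asymptotic bound. *)
Lemma interpolation_error_affine : exists A B : R, 0 <= B /\
  forall x : 'rV[R]_d, orthant x -> `|interpolation f x| <= A + B * vol x.
Proof.
have [N [N0 t0N fN]] := lattice_error_le ltr01.
set c : R := 2 ^+ d.
have c0 : 0 <= c by rewrite exprn_ge0 // ler0n.
have N0' : 0 < N%:R :> R by rewrite ltr0n.
(* [A] absorbs the finitely many lattice points with all coordinates below [N]; elsewhere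
   [p s <= (p N / N) * s]. *)
pose A := \sum_(g : {ffun 'I_d -> 'I_N}) `|f [ffun i => nat_of_ord (g i)]|.
have A0 : 0 <= A by apply: sumr_ge0.
pose B := p N%:R / N%:R.
have B0 : 0 <= B by rewrite divr_ge0 ?p_ge0 // ltW.
have fAB n : `|f n| <= A + B * vol (lattice_pt R n).
  have Bn0 := mulr_ge0 B0 (vol_lattice_pt_ge0 R n).
  have [npos|nneg] := pselect (pos_lattice n); last first.
    by rewrite f_eq0 // normr0 addr_ge0.
  have [Nn|nN] := pselect (exists j, (N <= n j)%N).
    have [Nvol fn] := fN n npos Nn; rewrite mul1r in fn.
    apply: le_trans fn _; have [_] := p_reg t0N Nvol.
    rewrite -ler_pdivlMr // => pn; apply: le_trans pn _.
    by rewrite /B [leRHS]addrC mulrAC lerDl.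
  have nN' i : (n i < N)%N.
    by rewrite ltnNge; apply/negP => Ni; apply: nN; exists i.
  rewrite -[leLHS]addr0 lerD // /A (bigD1 [ffun i => Ordinal (nN' i)]) //=.
  rewrite (_ : [ffun i => _] = n) ?lerDl ?sumr_ge0 //.
  by apply/ffunP => i; rewrite !ffunE.
exists (c * A), (c * (B * c)); split; first by rewrite mulr_ge0 // mulr_ge0.
move=> x x0; rewrite -2!mulrA -mulrDr.
apply: normr_interpolation_le => // v n /andP[v0 v1] _ vn.
apply: le_trans (ler_wpM2l v0 (fAB n)) _; rewrite mulrDr lerD //.
  by rewrite ler_piMl.
by rewrite mulrCA ler_wpM2l.
Qed.
End LatticeError.

(** * Inversion of the error bounds at level [t] *)

Lemma renewal_volume_bounds (R : realType) (d : nat) (mu eps t0 : R)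
    (p : R -> R) (S : 'rV[R]_d -> R) :
  0 < mu -> 0 < eps -> (forall t, 0 <= t -> 0 <= p t) ->
  eventually_regular t0 p ->
  (forall delta, 0 < delta -> exists X0, forall x, orthant x -> X0 <= vol x ->
     `|S x - mu * vol x| <= delta * p (vol x)) ->
  (exists A B, 0 <= B /\ forall x, orthant x ->
     `|S x - mu * vol x| <= A + B * vol x) ->
  \forall t \near +oo, forall x, orthant x ->
    (t / mu + eps * p t <= vol x -> t <= S x) /\
    (t <= S x -> t / mu - eps * p t <= vol x).
Proof.
move=> mu0 eps0 p_ge0 p_reg0 S_err [A [B [B0 S_aff]]].
pose t1 := Num.max t0 1.
have t1_gt0 : 0 < t1 by rewrite lt_max ltr01 orbT.
have p_reg s t : t1 <= s -> s <= t -> p s <= p t /\ p t * s <= p s * t.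
  by rewrite ge_max => /andP[/p_reg0 + _]; exact.
pose D := p t1 / t1.
have D0 : 0 <= D by rewrite divr_ge0 ?p_ge0 // ltW.
have pD s : t1 <= s -> p s <= D * s.
  by move=> /(p_reg _ _ (lexx t1))[_]; rewrite -ler_pdivlMr // mulrAC.
(* As [p t <= D * t], this makes both [t / mu + eps * p t <= C * t] and [1 <= C]. *)
pose C := mu^-1 + eps * D + 1.
have muV0 : 0 < mu^-1 by rewrite invr_gt0.
have epsD := mulr_ge0 (ltW eps0) D0.
have C1 : 1 <= C by rewrite lerDr addr_ge0 // ltW.
have C0 : 0 < C := lt_le_trans ltr01 C1.
have pC s t : t1 <= t -> t1 <= s -> s <= C * t -> p s <= C * p t.
  move=> tt ts sC; have [psC _] := p_reg _ _ ts sC; apply: le_trans psC _.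
  have t_gt0 := lt_le_trans t1_gt0 tt.
  have tCt : t <= C * t by rewrite ler_peMl // ltW.
  have [_] := p_reg _ _ tt tCt.
  by rewrite mulrA ler_pM2r // [p t * C]mulrC.
(* With [p s <= C * p t], the error [delta * p s] is then at most [mu * eps * p t]. *)
pose delta := mu * eps / C.
have delta0 : 0 < delta by rewrite divr_gt0 ?mulr_gt0.
have deltaC : delta * C = mu * eps by rewrite divfK // lt0r_neq0.
have deltaD : delta * D <= mu.
  rewrite -(ler_pM2r C0) mulrAC deltaC -mulrA ler_pM2l // /C.
  by rewrite -addrA addrCA lerDl addr_ge0 // ltW.
have [X0 S_X0] := S_err delta delta0.
pose Y := Num.max X0 t1.
near=> t => x x0.
have tt1 : t1 <= t by near: t; apply: nbhs_pinfty_ge; rewrite num_real.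
(* Volumes from [Y] on admit the asymptotic bound, and [t / mu] is one of them. *)
have tY : Y <= t / mu.
  by rewrite ler_pdivlMr //; near: t; apply: nbhs_pinfty_ge; rewrite num_real.
(* By the affine bound, points of volume below [Y] then stay under level [t]. *)
have tA : A + (B + mu) * Y < t.
  by near: t; apply: nbhs_pinfty_gt; rewrite num_real.
have YX0 : X0 <= Y by rewrite le_max lexx.
have Yt1 : t1 <= Y by rewrite le_max lexx orbT.
have t_gt0 := lt_le_trans t1_gt0 tt1.
have pt0 := p_ge0 t (ltW t_gt0).
have epspt := mulr_ge0 (ltW eps0) pt0.
split.
  set s1 := t / mu + _ => s1x; set s := vol x in s1x *.
  have s1Y : Y <= s1 by rewrite (le_trans tY) // lerDl.
  have s1t1 := le_trans Yt1 s1Y.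
  have s1_gt0 := lt_le_trans t1_gt0 s1t1.
  have [ps1s ps] := p_reg _ _ s1t1 s1x.
  have s1C : s1 <= C * t.
    have : eps * p t <= eps * D * t by rewrite -mulrA ler_pM2l // pD.
    by rewrite /s1 /C !mulrDl mul1r [t / _]mulrC; lra.
  have ps1 := ler_wpM2l (ltW delta0) (pC _ _ tt1 s1t1 s1C).
  rewrite mulrA deltaC in ps1.
  have mus1 : mu * s1 = t + mu * eps * p t.
    by rewrite /s1; field; exact: lt0r_neq0.
  (* Past [s1] the lower bound [mu * s - delta * p s] does not fall below its value at [s1]: the
     chords of [p] from [s1] have slope at most [D], and [delta * D <= mu]. *)
  have : delta * (p s - p s1) <= mu * (s - s1).
    have : p s - p s1 <= D * (s - s1).
      rewrite -(ler_pM2r s1_gt0).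
      have : p s1 * (s - s1) <= D * s1 * (s - s1).
        by rewrite ler_wpM2r ?subr_ge0 // pD.
      by nra.
    move=> /(ler_wpM2l (ltW delta0))/le_trans; apply.
    by rewrite mulrA ler_wpM2r // subr_ge0.
  have := S_X0 x x0 (le_trans (le_trans YX0 s1Y) s1x).
  by rewrite -/s ler_norml => /andP[? _]; lra.
apply: contraTT; rewrite -!ltNge => xs2.
have sx0 := vol_ge0 x0.
have mux : mu * vol x < t - mu * eps * p t.
  have <- : mu * (t / mu - eps * p t) = t - mu * eps * p t.
    by field; exact: lt0r_neq0.
  by rewrite ltr_pM2l.
have [Yx|xY] := leP Y (vol x).
  have xC : vol x <= C * t.
    rewrite /C !mulrDl mul1r.
    have := mulr_ge0 epsD (ltW t_gt0).
    by move: xs2; rewrite [t / _]mulrC; lra.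
  have px := ler_wpM2l (ltW delta0) (pC _ _ tt1 (le_trans Yt1 Yx) xC).
  rewrite mulrA deltaC in px.
  have := S_X0 x x0 (le_trans YX0 Yx).
  by rewrite ler_norml => /andP[_ ?]; lra.
have := S_aff x x0; rewrite ler_norml => /andP[_ Sx].
apply: le_lt_trans tA.
have := ler_wpM2l (addr_ge0 B0 (ltW mu0)) (ltW xY); lra.
Unshelve. all: by end_near. Qed.

(** * Rescaled renewal sets on the almost sure event *)

Theorem theorem2p2 (R : realType) (disp : measure_display)
    (T : measurableType disp) (P : probability T R)
    (d : nat) (hd : (2 <= d)%N)
    (xi0 : {RV P >-> R}) (xi : lattice d -> {RV P >-> R}) (mu : R)
    (h_copies : independent_copies pos_lattice xi xi0)
    (h_int : P.-integrable [set: T] (EFin \o xi0))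
    (h_mean : 'E_P[xi0]%E = mu%:E) (h_mu : 0 < mu)
    (p : R -> R)
    (p_ge0 : forall t, 0 <= t -> 0 <= p t)
    (p_ORV : O_regularly_varying p)
    (p_mono : exists t0 : R,
      {in `[t0, +oo[ &, {homo p : s t / s <= t}} /\
      {in `[t0, +oo[ &, {homo (fun t => t^-1 * p t) : s t /~ s <= t}})
    (h_slln : {ae P, forall w,
      (fun n : lattice d =>
         partial_sum (fun m => xi m w) n - mu * vol (lattice_pt R n))
      =o_lattice_infty (fun n => p (vol (lattice_pt R n)))}) :
  forall eps : R, 0 < eps ->
    {ae P, forall w, \forall t \near +oo,
      let St := scale_set (t `^ (- d%:R^-1))
                  (renewal_set (partial_sum (fun m => xi m w)) t) in
      hyperbolic_set mu (eps * p t * t^-1) `<=` St /\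
      St `<=` hyperbolic_set mu (- (eps * p t * t^-1))}.
Proof.
move=> eps eps0; have [t0 [p_homo p_div]] := p_mono.
have p_reg : eventually_regular (Num.max t0 1) p.
  move=> s t; rewrite ge_max => /andP[t0s s1] st.
  have t0t := le_trans t0s st.
  have s_gt0 : 0 < s := lt_le_trans ltr01 s1.
  have t_gt0 : 0 < t := lt_le_trans s_gt0 st.
  have [sI tI] : s \in `[t0, +oo[ /\ t \in `[t0, +oo[.
    by rewrite !in_itv /= t0s t0t.
  split; first exact: p_homo.
  have := p_div t s tI sI st.
  by rewrite ![_^-1 * _]mulrC ler_pdivrMr // mulrAC ler_pdivlMr.
apply: filterS h_slln => w slln; set S := partial_sum _ in slln *.
set f := (fun n => _ - _) in slln.
(* The hypothesis controls only points with positive coordinates, but cube vertices may lie on the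
   coordinate faces, where both terms of [f] vanish. *)
have f_eq0 n : ~ pos_lattice n -> f n = 0.
  by move=> nn; rewrite /f /S partial_sum_eq0 //
    vol_lattice_pt_eq0 // mulr0 subr0.
have volume_bounds : \forall t \near +oo, forall x, orthant x ->
    (t / mu + eps * p t <= vol x -> t <= interpolation S x) /\
    (t <= interpolation S x -> t / mu - eps * p t <= vol x).
  apply: (renewal_volume_bounds h_mu eps0 p_ge0 p_reg).
    move=> delta /(interpolation_error_le p_ge0 p_reg f_eq0 slln)[X0 fX0].
    by exists X0 => x x0 xX0; rewrite -interpolation_sub //; exact: fX0.
  have [A [B [B0 fAB]]] := interpolation_error_affine p_ge0 p_reg f_eq0 slln.
  by exists A, B; split=> // x x0; rewrite -interpolation_sub //; exact: fAB.
near=> t.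
have t_gt0 : 0 < t by near: t; exact: nbhs_pinfty_gt.
have vol_t : forall x, orthant x ->
    (t / mu + eps * p t <= vol x -> t <= interpolation S x) /\
    (t <= interpolation S x -> t / mu - eps * p t <= vol x) by near: t.
set a := t `^ _; have a_gt0 : 0 < a by exact: powR_gt0.
(* Scaling by [a] thus divides volumes by [t], which turns the thresholds [t / mu +- eps * p t] into
   those of the hyperbolic sets. *)
have ad : a ^+ d = t^-1.
  rewrite -powR_mulrn ?(ltW a_gt0) // -powRrM mulNr mulVf
    ?powR_inv1 ?(ltW t_gt0) //.
  by rewrite pnatr_eq0 -lt0n (leq_trans _ hd).
split=> [y [y0 yvol]|_ [x [x0 Sx] <-]].
  exists (a^-1 *: y); last by rewrite scalerA mulfV ?scale1r // lt0r_neq0.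
  have x0 : orthant (a^-1 *: y).
    by move=> i; rewrite mxE mulr_ge0 ?invr_ge0 ?(ltW a_gt0).
  split=> //; apply: (vol_t _ x0).1.
  rewrite vol_scale exprVn ad invrK -(ler_pM2l t_gt0) in yvol *.
  by rewrite mulrDr mulrCA mulfV ?mulr1 // lt0r_neq0 in yvol.
split; first by move=> i; rewrite mxE mulr_ge0 // ltW.
rewrite vol_scale ad -(ler_pM2l t_gt0) mulVKf ?lt0r_neq0 //.
rewrite mulrBr mulrCA mulfV ?mulr1 ?lt0r_neq0 //.
exact: (vol_t _ x0).2.
Unshelve. all: by end_near. Qed.
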